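(* Let $A$ be a unital Banach algebra, $G$ a finite group and $\alpha$ an action of $G$ on $A$. Then $$\mathrm{ltsr}(\ell^1(G, A, \alpha)) \leq \mathrm{ltsr}(A) + |G| - 1 .$$
   Context: $\mathrm{Aut}(A)$ is the group of bounded algebra automorphisms of $A$ with bounded inverse. An action of a discrete group $G$ on $A$ is a map $g\mapsto \alpha^g \in \mathrm{Aut}(A)$ with $\sup_{g}\|\alpha^g\|<\infty$, $\alpha^e=\mathrm{id}$ and $\alpha^{gh}=\alpha^g\alpha^h$. The Banach algebra $\ell^1(G,A,\alpha)$ consists of all $f\colon G\to A$ with $\|f\|=\sum_{g\in G}\|f(g)\|<\infty$, with product $(f_1*f_2)(g)=\sum_{h\in G} f_1(h)\,\alpha^h(f_2(h^{-1}g))$. For a unital ring $A$, $Lg_n(A)$ denotes the set of $n$-tuples of elements of $A$ which generate $A$ as a left ideal. For a unital Banach algebra $A$, the left topological stable rank $\mathrm{ltsr}(A)$ is the least integer $n \ge 1$ such that $Lg_n(A)$ is dense in $A^n$ (and $\infty$ if no such $n$ exists). *)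

(* Defs.v *)
From HB Require Import structures.
From mathcomp Require Import all_boot all_order all_algebra all_fingroup.
From mathcomp Require Import boolp classical_sets functions reals
  constructive_ereal topology normedtype.

Set Implicit Arguments.
Unset Strict Implicit.
Unset Printing Implicit Defensive.

Import Order.TTheory GRing.Theory Num.Theory.
Import numFieldNormedType.Exports.

Local Open Scope classical_set_scope.
Local Open Scope ring_scope.

(* Unital Banach algebras over a numeric field [K]; real and complex Banach
   algebras are obtained with [K := R] and [K := R[i]] for [R : realType].
   Multiplication is only required to be bounded, with some constant [C]:
   submultiplicative norms are the case [C = 1]. The norm of l^1(G, A, alpha) is
   not submultiplicative in general, since the alpha^g need not be contractive.

   The multiplication is a field of the record, rather than inherited from
   [algType K], because the hierarchy has no join of rings and normed modules
   below [numDomainType] and none can be added afterwards. The instances on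
   [banach_carrier] below make every [A : banachAlgType K] both an [algType K]
   and a [completeNormedModType K], with a shared module structure. *)
Record banachAlgType (K : numFieldType) := BanachAlgType {
  banach_space : completeNormedModType K;
  banach_one : banach_space;
  banach_mul : banach_space -> banach_space -> banach_space;
  banach_mulA : associative banach_mul;
  banach_mul1l : left_id banach_one banach_mul;
  banach_mul1r : right_id banach_one banach_mul;
  banach_mulDl : left_distributive banach_mul +%R;
  banach_mulDr : right_distributive banach_mul +%R;
  banach_one_neq0 : banach_one != 0;
  banach_scaleAl : forall (k : K) x y,
    k *: banach_mul x y = banach_mul (k *: x) y;
  banach_scaleAr : forall (k : K) x y,
    k *: banach_mul x y = banach_mul x (k *: y);
  banach_mul_bounded : exists C : K, forall x y,
    `|banach_mul x y| <= C * (`|x| * `|y|)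
}.

Definition banach_carrier (K : numFieldType) (A : banachAlgType K) : Type :=
  banach_space A.
Coercion banach_carrier : banachAlgType >-> Sortclass.

Section BanachCarrier.
Context (K : numFieldType) (A : banachAlgType K).

HB.instance Definition _ :=
  CompleteNormedModule.copy (banach_carrier A) (banach_space A).

HB.instance Definition _ := GRing.Zmodule_isNzRing.Build (banach_carrier A)
  (@banach_mulA K A) (@banach_mul1l K A) (@banach_mul1r K A)
  (@banach_mulDl K A) (@banach_mulDr K A) (@banach_one_neq0 K A).

HB.instance Definition _ :=
  GRing.Lmodule_isLalgebra.Build K (banach_carrier A) (@banach_scaleAl K A).

HB.instance Definition _ :=
  GRing.Lalgebra_isAlgebra.Build K (banach_carrier A) (@banach_scaleAr K A).

Lemma norm_mul_bounded :
  exists C : K, forall x y : A, `|x * y| <= C * (`|x| * `|y|).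
Proof. exact: banach_mul_bounded. Qed.

End BanachCarrier.

Definition norm_bounded_map (K : numFieldType) (V W : normedModType K)
    (f : V -> W) :=
  exists M : K, forall x, `|f x| <= M * `|x|.

Record banach_aut (K : numFieldType) (A : banachAlgType K) := BanachAut {
  banach_aut_fun :> {lrmorphism A -> A};
  banach_aut_bounded : norm_bounded_map banach_aut_fun;
  banach_aut_inv : exists f' : A -> A,
    [/\ cancel banach_aut_fun f', cancel f' banach_aut_fun &
        norm_bounded_map f']
}.

(* [banach_act_bounded] states that the operator norms of the a^g have a
   common bound. *)
Record banach_action (K : numFieldType) (G : groupType)
    (A : banachAlgType K) := BanachAction {
  banach_act :> G -> banach_aut A;
  banach_act_bounded :
    exists M : K, forall g a, `|banach_act g a| <= M * `|a|;
  banach_act1 : forall a, banach_act 1%g a = a;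
  banach_actM : forall g h a,
    banach_act (g * h)%g a = banach_act g (banach_act h a)
}.

(* For finite [G], every function [G -> A] is summable. The action is a parameter
   of the type only because the product depends on it. *)
Definition l1_space (K : numFieldType) (G : finGroupType) (A : banachAlgType K)
  (alpha : banach_action G A) : Type := {ffun G -> A}.

Section L1.
Context (K : numFieldType) (G : finGroupType) (A : banachAlgType K).
Variable alpha : banach_action G A.
Local Notation L := (l1_space alpha).
Implicit Types f : L.

HB.instance Definition _ := GRing.Lmodule.copy L {ffun G -> A}.

Definition l1_fun f : G -> A := fun g => (f : {ffun G -> A}) g.

Definition l1_norm f : K := \sum_(g : G) `|l1_fun f g|.

Definition l1_conv f1 f2 : L :=
  [ffun g : G => \sum_(h : G) l1_fun f1 h * alpha h (l1_fun f2 (h^-1 * g)%g)].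

Definition l1_one : L := [ffun g : G => if g == 1%g then 1 else 0].

Lemma l1P f1 f2 : l1_fun f1 =1 l1_fun f2 -> f1 = f2.
Proof. by move=> eqf; apply/ffunP. Qed.

Lemma l1_funD f1 f2 g : l1_fun (f1 + f2) g = l1_fun f1 g + l1_fun f2 g.
Proof. by rewrite /l1_fun ffunE. Qed.

Lemma l1_funZ (k : K) f g : l1_fun (k *: f) g = k *: l1_fun f g.
Proof. by rewrite /l1_fun ffunE. Qed.

Lemma l1_fun_conv f1 f2 g : l1_fun (l1_conv f1 f2) g =
  \sum_(h : G) l1_fun f1 h * alpha h (l1_fun f2 (h^-1 * g)%g).
Proof. by rewrite /l1_fun ffunE. Qed.

Lemma l1_fun_one g : l1_fun l1_one g = if g == 1%g then 1 else 0.
Proof. by rewrite /l1_fun ffunE. Qed.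

Lemma l1_convA : associative l1_conv.
Proof.
move=> f1 f2 f3; apply: l1P => g; rewrite !l1_fun_conv.
under eq_bigr => h _ do rewrite l1_fun_conv rmorph_sum mulr_sumr.
under [RHS]eq_bigr => h _ do rewrite l1_fun_conv mulr_suml.
rewrite [RHS]exchange_big; apply: eq_bigr => h _ /=.
rewrite [RHS](reindex_inj (mulgI h)); apply: eq_bigr => k _ /=.
by rewrite mulKg invMg -mulgA banach_actM rmorphM mulrA.
Qed.

Lemma l1_conv1l : left_id l1_one l1_conv.
Proof.
move=> f; apply: l1P => g; rewrite l1_fun_conv (bigD1 1%g)//= big1 ?addr0.
  by rewrite l1_fun_one eqxx mul1r banach_act1 invg1 mul1g.
by move=> h /negPf h1; rewrite l1_fun_one h1 mul0r.
Qed.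

Lemma l1_conv1r : right_id l1_one l1_conv.
Proof.
move=> f; apply: l1P => g; rewrite l1_fun_conv (bigD1 g)//= big1 ?addr0.
  by rewrite mulVg l1_fun_one eqxx rmorph1 mulr1.
move=> h hg; rewrite l1_fun_one -eq_invg_mul invgK (negPf hg).
by rewrite rmorph0 mulr0.
Qed.

Lemma l1_convDl : left_distributive l1_conv +%R.
Proof.
move=> f1 f2 f3; apply: l1P => g; rewrite l1_funD !l1_fun_conv -big_split.
by apply: eq_bigr => h _; rewrite l1_funD mulrDl.
Qed.

Lemma l1_convDr : right_distributive l1_conv +%R.
Proof.
move=> f1 f2 f3; apply: l1P => g; rewrite l1_funD !l1_fun_conv -big_split.
by apply: eq_bigr => h _; rewrite l1_funD rmorphD mulrDr.
Qed.

Lemma l1_one_neq0 : l1_one != 0.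
Proof.
apply/eqP => /(congr1 (fun f => l1_fun f 1%g)).
by rewrite l1_fun_one eqxx /l1_fun ffunE => /eqP; rewrite oner_eq0.
Qed.

Lemma l1_scaleAl (k : K) f1 f2 : k *: l1_conv f1 f2 = l1_conv (k *: f1) f2.
Proof.
apply: l1P => g; rewrite l1_funZ !l1_fun_conv scaler_sumr.
by apply: eq_bigr => h _; rewrite l1_funZ scalerAl.
Qed.

Lemma l1_scaleAr (k : K) f1 f2 : k *: l1_conv f1 f2 = l1_conv f1 (k *: f2).
Proof.
apply: l1P => g; rewrite l1_funZ !l1_fun_conv scaler_sumr.
by apply: eq_bigr => h _; rewrite l1_funZ linearZ scalerAr.
Qed.

Lemma l1_normD f1 f2 : l1_norm (f1 + f2) <= l1_norm f1 + l1_norm f2.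
Proof.
rewrite /l1_norm -big_split ler_sum// => g _.
by rewrite l1_funD ler_normD.
Qed.

Lemma l1_normZ (k : K) f : l1_norm (k *: f) = `|k| * l1_norm f.
Proof.
rewrite /l1_norm mulr_sumr; apply: eq_bigr => g _.
by rewrite l1_funZ normrZ.
Qed.

Lemma l1_norm0_eq0 f : l1_norm f = 0 -> f = 0.
Proof.
move=> /eqP; rewrite psumr_eq0// => /allP f0; apply: l1P => g.
by have /eqP/normr0_eq0 -> := f0 g (mem_index_enum g); rewrite /l1_fun ffunE.
Qed.

HB.instance Definition _ :=
  Lmodule_isNormed.Build K L l1_normD l1_normZ l1_norm0_eq0.

Lemma l1_normE f : `|f| = \sum_(g : G) `|l1_fun f g|.
Proof. by []. Qed.

Lemma le_l1_norm f g : `|l1_fun f g| <= `|f|.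
Proof. by rewrite l1_normE (bigD1 g)//= lerDl sumr_ge0. Qed.

Lemma l1_funB f1 f2 g : l1_fun (f1 - f2) g = l1_fun f1 g - l1_fun f2 g.
Proof. by rewrite /l1_fun !ffunE. Qed.

Lemma l1_complete (F : set_system L) : ProperFilter F -> cauchy F -> cvg F.
Proof.
move=> FF /cauchyP Fc.
have cvF g : cvg ((fun f : L => l1_fun f g) @ F).
  apply: cauchy_cvg; apply/cauchyP => e e0.
  have [f Ff] := Fc e e0; exists (l1_fun f g).
  rewrite -[_ (ball _ _)]/(F [set f' | ball (l1_fun f g) e (l1_fun f' g)]).
  apply: filterS Ff => f' /=; rewrite -!ball_normE /ball_/= => ff'.
  by have := le_l1_norm (f - f') g; rewrite l1_funB => /le_lt_trans; apply.
pose l : L := [ffun g : G => lim ((fun f : L => l1_fun f g) @ F)].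
apply/cvg_ex; exists l; apply/cvgrPdist_lt => e e0.
pose d := e / #|G|%:R.
have G0 : 0 < #|G|%:R :> K by rewrite ltr0n; apply/card_gt0P; exists 1%g.
have d0 : 0 < d by rewrite divr_gt0.
have lE g : l1_fun l g = lim ((fun f : L => l1_fun f g) @ F).
  by rewrite /l1_fun ffunE.
have /filter_forall : forall g,
    \forall f \near F, `|l1_fun l g - l1_fun f g| < d.
  by move=> g; rewrite lE; have /cvgrPdist_lt/(_ d d0) := cvF g.
apply: filterS => f lf; rewrite l1_normE.
have -> : e = \sum_(g : G) d.
  by rewrite sumr_const -[X in d *+ X]/(#|G|) -mulr_natr divfK// gt_eqF.
apply: ltr_sum => [|g _]; last by rewrite l1_funB.
by apply/hasP; exists 1%g; rewrite ?mem_index_enum.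
Qed.

HB.instance Definition _ := Uniform_isComplete.Build L l1_complete.

Lemma l1_mul_bounded :
  exists C : K, forall f1 f2, `|l1_conv f1 f2| <= C * (`|f1| * `|f2|).
Proof.
have [C HC] := norm_mul_bounded A.
have [M HM] := banach_act_bounded alpha.
have norm1_gt0 : 0 < `|1 : A| by rewrite normr_gt0 oner_eq0.
have C0 : 0 <= C.
  have := HC 1 1; rewrite mulr1 mulrA => /(le_trans (normr_ge0 _)).
  by rewrite !pmulr_lge0.
exists (C * M) => f1 f2; rewrite [X in X <= _]l1_normE.
apply: (@le_trans _ _ (\sum_g \sum_h
    C * M * (`|l1_fun f1 h| * `|l1_fun f2 (h^-1 * g)%g|))).
  apply: ler_sum => g _; rewrite l1_fun_conv (le_trans (ler_norm_sum _ _ _))//.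
  apply: ler_sum => h _; rewrite (le_trans (HC _ _))// -mulrA ler_wpM2l//.
  by rewrite mulrCA ler_wpM2l// HM.
rewrite exchange_big [`|f1|]l1_normE mulr_suml mulr_sumr.
apply: ler_sum => h _; rewrite [`|f2|]l1_normE !mulr_sumr.
by rewrite [leRHS](reindex_inj (mulgI h^-1%g)).
Qed.

Definition l1 : banachAlgType K :=
  @BanachAlgType K L l1_one l1_conv l1_convA l1_conv1l l1_conv1r
    l1_convDl l1_convDr l1_one_neq0 l1_scaleAl l1_scaleAr l1_mul_bounded.

End L1.

Definition Lg (A : pzRingType) (n : nat) : set 'rV[A]_n :=
  [set a | forall b : A, exists c : 'rV[A]_n, b = \sum_(i < n) c 0 i * a 0 i].

(* Extended integers rather than naturals, so that the -1 in the bound is not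
   truncated; the value is never [-oo]. *)
Definition ltsr (K : numFieldType) (A : banachAlgType K) : \bar int :=
  if pselect (exists n, (0 < n)%N && `[< dense (@Lg A n) >]) is left ex_n
  then (ex_minn ex_n)%:Z%:E else +oo%E.

(* Main.v *)
Require Import Defs.
From mathcomp Require Import all_boot all_order all_algebra all_fingroup.
From mathcomp Require Import boolp classical_sets functions reals
  constructive_ereal topology normedtype.

(** Let r = ltsr A and k = #|G|. A tuple of m elements of l^1(G, A, alpha) is
    the same thing as its m x k matrix T of coefficients in A. If T has a left
    inverse L over A, then the tuple generates l^1(G, A, alpha) as a left ideal:
    a constant of A, placed at the identity of G, multiplies on the left
    coefficient by coefficient because alpha^1 is the identity, so combining the
    tuple with the row of L indexed by the identity of G gives 1
    ([Lg_l1_row]).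

    It remains to see that left invertible m x k matrices over A are dense for
    m = r + k - 1 ([left_invertible_dense_of_Lg]), by induction on k. For k = 1
    and m = r this is the definition of r, and adding rows preserves density.
    For the step, cut off the first row and the first column:
    T = [[y, w], [x, B]]. The column x still has at least r entries, so after a
    perturbation it has a left inverse, and d can be chosen with y + d x = 1.
    Row operations then turn T into [[1, u], [0, B - x u]] with u = w + d B. By
    induction B - x u can be approximated by a left invertible matrix B1; taking
    B' = B1 + x u and w' = u - d B' leaves u unchanged, and gives a left
    invertible [[y, w'], [x, B']] close to T
    ([left_invertible_dense_block]). *)

Set Implicit Arguments.
Unset Strict Implicit.
Unset Printing Implicit Defensive.

Import Order.TTheory GRing.Theory Num.Theory.
Import numFieldNormedType.Exports.

Local Open Scope classical_set_scope.
Local Open Scope ring_scope.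

(** * Left invertible matrices *)

Definition left_invertible (A : pzRingType) (m n : nat) (T : 'M[A]_(m, n)) :=
  exists L : 'M[A]_(n, m), L *m T = 1%:M.

Lemma left_invertible_col_mx (A : pzRingType) (p m n : nat)
    (t : 'M[A]_(p, n)) (T : 'M[A]_(m, n)) :
  left_invertible T -> left_invertible (col_mx t T).
Proof.
by move=> [L LT]; exists (row_mx 0 L); rewrite mul_row_col mul0mx add0r.
Qed.

(** Adding [d] times the lower rows to the first one makes the corner 1, and
    clearing the column below it leaves [[1, u], [0, B - x u]], which has the left
    inverse [[1, - u L], [0, L]]. The witness is the product of that inverse with
    the matrix of the row operations. *)
Lemma left_invertible_block (A : pzRingType) (m n : nat) (y : 'M[A]_1)
    (w : 'rV[A]_n) (x : 'cV[A]_m) (B : 'M[A]_(m, n)) (d : 'rV[A]_m) :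
  y + d *m x = 1%:M -> left_invertible (B - x *m (w + d *m B)) ->
  left_invertible (block_mx y w x B).
Proof.
set u := w + d *m B => dx1 [L LB].
pose r := row_mx 1%:M d; pose s := row_mx (- (L *m x)) (L - L *m x *m d).
exists (col_mx (r - u *m s) s).
have rT : r *m block_mx y w x B = row_mx 1%:M u.
  by rewrite mul_row_block !mul1mx dx1.
have sT : s *m block_mx y w x B = row_mx 0 1%:M.
  rewrite mul_row_block; congr row_mx.
    rewrite mulmxBl -(mulmxA _ d) !mulNmx addrCA -opprD -mulmxDr dx1.
    by rewrite mulmx1 subrr.
  rewrite -LB mulmxBr mulmxBl !mulNmx /u !mulmxDr !mulmxA opprD.
  by rewrite addrCA.
rewrite mul_col_mx mulmxBl rT -mulmxA sT mul_mx_row mulmx0 mulmx1.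
by rewrite opp_row_mx oppr0 add_row_mx addr0 subrr -block_mxEv -scalar_mx_block.
Qed.

Lemma Lg_left_invertible (A : pzRingType) (n : nat) (a : 'rV[A]_n) :
  Lg a <-> left_invertible a^T.
Proof.
split=> [/(_ 1) [c c1]|[L La] b].
  exists c; apply/matrixP => i j; rewrite !ord1 !mxE c1.
  by apply: eq_bigr => k _; rewrite mxE.
exists (b *: L); have /matrixP/(_ 0 0) := La; rewrite !mxE /= => L1.
rewrite -[LHS]mulr1 -[1 in LHS]L1 mulr_sumr; apply: eq_bigr => i _.
by rewrite !mxE mulrA.
Qed.

(** * Density of left invertible matrices *)

Section Density.
Context (K : numFieldType) (A : banachAlgType K).

Definition left_invertible_dense (m n : nat) :=
  forall (T : 'M[A]_(m, n)) (e : K), 0 < e ->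
  exists2 T' : 'M[A]_(m, n),
    left_invertible T' & forall i j, `|T i j - T' i j| < e.

(** Left multiplication by a fixed matrix is continuous at 0: the product
    is bounded by the entries of [D] up to [C] times the sum of the norms of the
    entries of [d]. *)
Lemma mulmx_small (m n : nat) (d : 'M[A]_(m, n)) (p : nat) (e : K) : 0 < e ->
  exists2 e' : K, 0 < e' & forall D : 'M[A]_(n, p),
    (forall i j, `|D i j| < e') -> forall i j, `|(d *m D) i j| < e.
Proof.
move=> e0; have [C HC] := norm_mul_bounded A.
have norm1_gt0 : 0 < `|1 : A| by rewrite normr_gt0 oner_eq0.
have C0 : 0 <= C.
  have := HC 1 1; rewrite mulr1 mulrA => /(le_trans (normr_ge0 _)).
  by rewrite !pmulr_lge0.
pose S := C * \sum_i \sum_l `|d i l|.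
have S0 : 0 <= S by rewrite mulr_ge0// sumr_ge0// => i _; rewrite sumr_ge0.
have S1 : 0 < S + 1 by rewrite ltr_wpDl.
(* The summand 1 covers the case [S = 0]. *)
exists (e / (S + 1)) => [|D De i j]; first by rewrite divr_gt0.
apply: (@le_lt_trans _ _ (S * (e / (S + 1)))); last first.
  by rewrite mulrCA gtr_pMr// ltr_pdivrMr// mul1r ltrDl.
rewrite mxE (le_trans (ler_norm_sum _ _ _))//.
apply: (@le_trans _ _ (C * \sum_l `|d i l| * (e / (S + 1)))).
  rewrite mulr_sumr; apply: ler_sum => l _; rewrite (le_trans (HC _ _))//.
  by rewrite ler_wpM2l// ler_wpM2l// ltW.
rewrite -mulr_suml /S -mulrA ler_wpM2l// ler_wpM2r//.
  by rewrite ltW// divr_gt0.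
by rewrite (bigD1 i)//= lerDl sumr_ge0// => k _; rewrite sumr_ge0.
Qed.

Lemma left_invertible_dense_row (m n : nat) :
  left_invertible_dense m n -> left_invertible_dense m.+1 n.
Proof.
move=> dns T e e0; rewrite -[m.+1]/(1 + m)%N in T *.
have [B Binv TB] := dns (dsubmx T) e e0.
exists (col_mx (usubmx T) B); first exact: left_invertible_col_mx.
rewrite -{1}[T]vsubmxK => i j; case: (split_ordP i) => k ->.
  by rewrite !col_mxEu subrr normr0.
by rewrite !col_mxEd.
Qed.

(** The inductive step. Once the column [x] is left invertible, only [B] and [w]
    are perturbed; the change of [w] compensates for that of [B], so that the top
    row after the row operation is still [u]. *)
Lemma left_invertible_dense_block (m n : nat) :
  left_invertible_dense m 1 -> left_invertible_dense m n ->
  left_invertible_dense m.+1 n.+1.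
Proof.
move=> dns1 dns T e e0.
rewrite -[m.+1]/(1 + m)%N -[n.+1]/(1 + n)%N in T *.
rewrite -[T]submxK; move: (ulsubmx T) (ursubmx T) (dlsubmx T) (drsubmx T).
move=> y w x0 B {T}.
have [x [c cx] x0x] := dns1 x0 e e0.
pose d := (1%:M - y) *m c.
have dx : y + d *m x = 1%:M by rewrite -mulmxA cx mulmx1 addrC subrK.
have [e1 e10 de1] := mulmx_small d n e0.
pose u := w + d *m B.
pose e2 := Order.min e e1.
have e20 : 0 < e2 by rewrite /e2 /Order.min; case: ifP.
have cmp : (e >=< e1)%O by apply: real_comparable; exact: gtr0_real.
have [B1 B1inv BB1] := dns (B - x *m u) e2 e20.
pose B' := B1 + x *m u; pose w' := u - d *m B'.
have BB' i j : `|(B - B') i j| < e2.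
  by have := BB1 i j; rewrite /B' opprD addrCA addrC !mxE.
have ww' : w - w' = - (d *m (B - B')).
  by rewrite /w' /u mulmxBr -(addrA w) opprD addrA subrr add0r.
exists (block_mx y w' x B').
  apply: (left_invertible_block dx).
  by rewrite /w' subrK /B' addrK.
move=> i j; case: (split_ordP i) => k ->; case: (split_ordP j) => l ->.
- by rewrite !block_mxEul subrr normr0.
- rewrite !block_mxEur.
  have -> : w k l - w' k l = (w - w') k l by rewrite !mxE.
  rewrite ww' mxE normrN; apply: de1 => i' j'.
  by rewrite (lt_le_trans (BB' _ _))// comparable_ge_min// lexx orbT.
- by rewrite !block_mxEdl.
- rewrite !block_mxEdr.
  have -> : B k l - B' k l = (B - B') k l by rewrite !mxE.
  by rewrite (lt_le_trans (BB' _ _))// comparable_ge_min// lexx.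
Qed.

Lemma dense_rVP (n : nat) (S : set 'rV[A]_n) :
  dense S <-> forall (a : 'rV[A]_n) (e : K), 0 < e ->
    exists2 b, S b & forall i, `|a 0 i - b 0 i| < e.
Proof.
split=> [dS a e e0|dS O [a Oa] oO].
  have aO : nbhs a (ball a e) by exact: nbhsx_ballx.
  have [b [/interior_subset ab Sb]] : (ball a e)^° `&` S !=set0.
    by apply: dS (@open_interior _ _); exists a.
  by exists b => // i; case: ab => _ /(_ 0 i); rewrite -ball_normE.
have /nbhs_ballP [e /= e0 aeO] : nbhs a O by apply: open_nbhs_nbhs.
have [b Sb ab] := dS a e e0; exists b; split=> //; apply: aeO; split=> // i j.
by rewrite !ord1 -ball_normE; apply: ab.
Qed.

Lemma left_invertible_dense_rows (m p n : nat) : (m <= p)%N ->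
  left_invertible_dense m n -> left_invertible_dense p n.
Proof.
move=> /subnK <- dns; elim: (p - m)%N => // k IHk.
exact: left_invertible_dense_row.
Qed.

(** The column removed at each step has one entry fewer than the matrix has rows,
    hence at least [r] entries as long as a column remains. *)
Lemma left_invertible_dense_of_Lg (r k : nat) :
  dense (@Lg A r) -> left_invertible_dense (r + k) k.+1.
Proof.
move=> /dense_rVP dLg.
have dns1 : left_invertible_dense r 1.
  move=> T e e0; have [b /Lg_left_invertible binv Tb] := dLg T^T e e0.
  exists b^T => // i j; rewrite ord1 mxE.
  by have := Tb i; rewrite mxE.
elim: k => [|k IHk]; first by rewrite addn0.
rewrite addnS; apply: left_invertible_dense_block => //.
by apply: left_invertible_dense_rows dns1; rewrite leq_addr.
Qed.

End Density.

(** * Tuples in the crossed product as matrices over the coefficient algebra *)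

Section Crossed.
Context (K : numFieldType) (A : banachAlgType K) (G : finGroupType).
Variable alpha : banach_action G A.

Definition l1_const (a : A) : l1 alpha :=
  [ffun g : G => if g == 1%g then a else 0] : l1_space alpha.

Lemma l1_fun_constM (a : A) (f : l1 alpha) (g : G) :
  l1_fun (l1_const a * f : l1_space alpha) g = a * l1_fun (f : l1_space alpha) g.
Proof.
rewrite [LHS](l1_fun_conv (l1_const a) f) (bigD1 1%g)//= big1 ?addr0.
  by rewrite {1}/l1_fun ffunE eqxx banach_act1 invg1 mul1g.
by move=> h /negPf h1; rewrite {1}/l1_fun ffunE h1 mul0r.
Qed.

Definition l1_row (m : nat) (T : 'M[A]_(m, #|G|)) : 'rV[l1 alpha]_m :=
  \row_i ([ffun g : G => T i (enum_rank g)] : l1_space alpha).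

Lemma l1_fun_sum (m : nat) (F : 'I_m -> l1 alpha) (g : G) :
  l1_fun (\sum_i F i : l1_space alpha) g =
  \sum_i l1_fun (F i : l1_space alpha) g.
Proof.
apply: (big_morph (fun f : l1_space alpha => l1_fun f g)) => [f1 f2|].
  exact: l1_funD.
by rewrite /l1_fun ffunE.
Qed.

(** Combining the elements of the tuple with the constants in the row of [L]
    indexed by the identity of [G] gives the unit, whose multiples are
    everything. *)
Lemma Lg_l1_row (m : nat) (T : 'M[A]_(m, #|G|)) :
  left_invertible T -> Lg (l1_row T).
Proof.
move=> [L LT] b; pose c i := l1_const (L (enum_rank 1%g) i).
exists (\row_i (b * c i)); rewrite -[LHS]mulr1.
under eq_bigr => i _ do rewrite mxE -mulrA.
rewrite -mulr_sumr; congr (b * _).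
apply: (@l1P _ _ _ alpha) => g; rewrite [LHS]l1_fun_one l1_fun_sum.
under eq_bigr => i _ do rewrite l1_fun_constM /l1_row mxE /l1_fun ffunE.
have /matrixP/(_ (enum_rank 1%g) (enum_rank g)) := LT.
rewrite !mxE => ->; rewrite (inj_eq enum_rank_inj) eq_sym.
by case: eqP.
Qed.

(** The l^1 norm is the sum of [#|G|] coefficient norms, so approximating the
    coefficient matrix entrywise within [e / #|G|] gives a tuple within [e]. *)
Lemma dense_Lg_l1 (m : nat) :
  left_invertible_dense A m #|G| -> dense (@Lg (l1 alpha) m).
Proof.
move=> dns; apply/dense_rVP => a e e0.
have G0 : (0 < #|G|)%N by apply/card_gt0P; exists 1%g.
pose T : 'M[A]_(m, #|G|) :=
  \matrix_(i, j) l1_fun (a 0 i : l1_space alpha) (enum_val j).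
pose e' := e / #|G|%:R.
have e'0 : 0 < e' by rewrite divr_gt0// ltr0n.
have [T' T'inv TT'] := dns T e' e'0.
exists (l1_row T') => [|i]; first exact: Lg_l1_row.
rewrite [X in X < _]l1_normE.
have -> : e = \sum_(g : G) e'.
  by rewrite sumr_const -[X in e' *+ X]/(#|G|) -mulr_natr divfK// pnatr_eq0 -lt0n.
apply: ltr_sum => [|g _].
  by apply/hasP; exists 1%g; rewrite ?mem_index_enum.
rewrite l1_funB {2}/l1_fun mxE ffunE.
by have := TT' i (enum_rank g); rewrite mxE enum_rankK.
Qed.

End Crossed.

Theorem mainTheorem3 (K : numFieldType) (A : banachAlgType K)
    (G : finGroupType) (alpha : banach_action G A) :
  (ltsr (l1 alpha) <= ltsr A + #|G|%:Z%:E - 1%:E)%E.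
Proof.
have [k Gk] : exists k, #|G| = k.+1.
  by exists #|G|.-1; rewrite prednK//; apply/card_gt0P; exists 1%g.
rewrite {2}/ltsr; case: pselect => [exA|_]; last by rewrite leey.
case: ex_minnP => r /andP[r0 /asboolP dLg] _.
have dl1 : dense (@Lg (l1 alpha) (r + k)).
  by apply: dense_Lg_l1; rewrite Gk; exact: left_invertible_dense_of_Lg.
have rk : (0 < r + k)%N && `[< dense (@Lg (l1 alpha) (r + k)) >].
  by rewrite addn_gt0 r0; apply/asboolP.
rewrite /ltsr; case: pselect => [ex1|]; last by case; exists (r + k)%N.
case: ex_minnP => q _ /(_ _ rk) qrk.
by rewrite Gk -EFinD lee_fin -addn1 PoszD addrA addrK -PoszD lez_nat.
Qed.
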